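(* Let $k\ge 3$, $2<p<n\le k$, and let $f\in P_k^n$ depend essentially on all of its $n$ variables. Then $f\in G_{p,k}^n$ if and only if there exist $n-p$ variables $y_{l_1},\ldots,y_{l_{n-p}}\in\{x_1,\ldots,x_n\}$ such that $f=h\oplus g$, where $h\in P_k^n$ satisfies $Ess(h)=\{y_{l_1},\ldots,y_{l_{n-p}}\}$ and $g\in G_{n,k}^n$. Moreover, when $f\in G_{p,k}^n$, such $h$ and $g$ can be chosen with $g_{i\leftarrow j}=0$ for all $1\le i,j\le n$ with $i\neq j$.
   Context: $K=\{0,1,\ldots,k-1\}$ is the ring of residues modulo $k$, $\oplus$ is addition modulo $k$ (applied pointwise to functions). $P_k^n$ is the set of all functions $K^n\to K$ in variables $x_1,\ldots,x_n$. A variable $x_i$ is essential in $g$ if changing only the $i$-th argument can change the value of $g$; $Ess(g)$ is the set of essential variables, $ess(g)=|Ess(g)|$. For $i\neq j$, $g_{i\leftarrow j}(a_1,\ldots,a_n)=g(a_1,\ldots,a_{i-1},a_j,a_{i+1},\ldots,a_n)$. $Min(g)$ is the set of all $g_{i\leftarrow j}$ with $i\neq j$ and $x_i,x_j\in Ess(g)$; $gap(g)=ess(g)-\max_{t\in Min(g)}ess(t)$. $G_{p,k}^m=\{f\in P_k^n: ess(f)=m,\ gap(f)=p\}$. *)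

(* Defs.v *)
From mathcomp Require Import all_boot all_order all_algebra.
Set Implicit Arguments.
Unset Strict Implicit.
Unset Printing Implicit Defensive.

(* The ring K of residues modulo k is 'Z_k, which is Z/kZ only when 1 < k.
   Both K^n and P_k^n are finite function types, so equality is extensional
   and the pointwise sum of functions is +%R on Pfun k n. *)
Notation Kn k n := {ffun 'I_n -> 'Z_k}.
Notation Pfun k n := {ffun Kn k n -> 'Z_k}.

Section EssentialVariables.
Variables (k n : nat).
Implicit Types (g : Pfun k n) (a : Kn k n) (i j : 'I_n).

Definition subst_at a i (v : 'Z_k) : Kn k n :=
  [ffun l => if l == i then v else a l].

Definition essential g i : bool :=
  [exists a : Kn k n, exists v : 'Z_k, g (subst_at a i v) != g a].

Definition Ess g : {set 'I_n} := [set i | essential g i].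

Definition ess g : nat := #|Ess g|.

(* g_{i <- j} *)
Definition minor g i j : Pfun k n := [ffun a => g (subst_at a i (a j))].

Definition Min g : {set Pfun k n} :=
  [set t | [exists i, exists j,
     [&& i != j, i \in Ess g, j \in Ess g & t == minor g i j]]].

(* A minor in Min g never has more essential variables than g, so the
   truncated subtraction is exact; when ess g < 2, Min g is empty and the
   maximum is 0 by convention. *)
Definition gap g : nat := ess g - \max_(t in Min g) ess t.

End EssentialVariables.

(* G_{p,k}^m inside P_k^n *)
Definition G (n p k m : nat) : {set Pfun k n} :=
  [set f | (ess f == m) && (gap f == p)].

(* Main.v *)
(** Let [m = n - p] be the largest essential arity of a minor of [f].  Some
    minor [h = f_{r<-s}] with [ess h = m] does not depend on [x_s]: if the chosen
    one does, identifying two variables outside [{r} :|: Ess h] (there are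
    [p - 1 >= 2] of them) yields one that does not.  Such an [h] agrees with [f]
    at every point with a repeated coordinate, by the maximality of [m].  Hence
    [g = f - h] is supported on injective points, so that it depends on every
    variable and all its minors vanish.  Conversely all the minors of
    [g \in G n n k n] are equal to one constant, so that the minors of [h + g]
    are those of [h] up to that constant. *)
Require Import Defs.
From mathcomp Require Import all_boot all_order all_algebra.
From mathcomp Require Import zify.
Import GRing.Theory.
Local Open Scope ring_scope.

Section Minors.
Variables (k n : nat).
Implicit Types (f g h : Pfun k n) (a b : Kn k n) (i j r s t u v w : 'I_n).

(** * Essential variables and minors *)

Lemma subst_atE a i x l : subst_at a i x l = if l == i then x else a l.
Proof. by rewrite ffunE. Qed.

Lemma subst_at_same a i j : a i = a j -> subst_at a i (a j) = a.
Proof. by move=> eq_a; apply/ffunP => l; rewrite subst_atE; case: eqP => // ->. Qed.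

Lemma essentialP g i :
  reflect (exists a x, g (subst_at a i x) != g a) (i \in Ess g).
Proof.
rewrite inE; apply: (iffP existsP) => -[a].
  by case/existsP => x gx; exists a, x.
by case=> x gx; exists a; apply/existsP; exists x.
Qed.

Lemma inessential g i a x : i \notin Ess g -> g (subst_at a i x) = g a.
Proof.
by move=> niE; apply/eqP; apply: contraNT niE => gx; apply/essentialP; exists a, x.
Qed.

(** Pass from [a] to [b] one disagreeing coordinate at a time; each such coordinate is
    inessential. *)
Lemma eq_on_Ess g a b : {in Ess g, a =1 b} -> g a = g b.
Proof.
have [N] := ubnP #|[set i | a i != b i]|.
elim: N a => // N IH a leN eq_ab.
have [->//|/eqP/ffunP ne_ab] := eqVneq a b.
have [i neq_i]: exists i, a i != b i.
  apply/existsP; apply: contra_notT ne_ab; rewrite negb_exists => /forallP eq_ab' l.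
  by apply/eqP; rewrite -[_ == _]negbK eq_ab'.
rewrite -(@inessential g i a (b i)); last first.
  by apply: contra neq_i => /eq_ab ->.
apply: IH => [|l lE]; last by rewrite subst_atE; case: eqP => [->|_] //; exact: eq_ab.
rewrite -ltnS; apply: leq_trans leN; rewrite ltnS; apply: proper_card.
apply/properP; split.
  by apply/subsetP => l; rewrite !inE subst_atE; case: (eqVneq l i) => // ->; rewrite eqxx.
by exists i; rewrite !inE ?subst_atE ?eqxx.
Qed.

Lemma minorE f i j a : minor f i j a = f (subst_at a i (a j)).
Proof. by rewrite ffunE. Qed.

Lemma minor_id f i j a : a i = a j -> minor f i j a = f a.
Proof. by move=> eq_a; rewrite minorE subst_at_same. Qed.

Lemma Ess_minorN f i j : i != j -> i \notin Ess (minor f i j).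
Proof.
move=> ij; apply/negP => /essentialP[a [x]]; rewrite !minorE => /eqP[].
congr (f _); apply/ffunP => l; rewrite !subst_atE.
by rewrite [j == i]eq_sym (negbTE ij); case: eqP.
Qed.

Lemma minor_inessential f i j : i \notin Ess f -> minor f i j = f.
Proof. by move=> iN; apply/ffunP => a; rewrite minorE inessential. Qed.

(** Only $x_j$ can become essential. If $x_i$ is essential in [f], its loss makes up for $x_j$;
    otherwise the minor is [f] itself. *)
Lemma ess_minor_le f i j : i != j -> (ess (minor f i j) <= ess f)%N.
Proof.
move=> ij.
have [iE|/minor_inessential ->//] := boolP (i \in Ess f).
have sub_lj l : l \in Ess (minor f i j) -> l != j -> l \in Ess f.
  move=> lM lj; apply: contraLR lM => lN; apply/negP => /essentialP[a [x]].
  rewrite !minorE => /eqP[]; apply: eq_on_Ess => e eE; rewrite !subst_atE.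
  rewrite [j == l]eq_sym (negbTE lj).
  by case: (eqVneq e l) => // e_l; rewrite e_l (negbTE lN) in eE.
have [jE|jN] := boolP (j \in Ess (minor f i j)); last first.
  apply: subset_leq_card; apply/subsetP => l lM; apply: sub_lj => //.
  by apply: contraTneq lM => ->.
rewrite /ess (cardsD1 j) jE (cardsD1 i (Ess f)) iE ltnS.
apply: subset_leq_card; apply/subsetP => l; rewrite !inE => /andP[lj lM].
have lM' : l \in Ess (minor f i j) by rewrite inE.
have := sub_lj _ lM' lj; rewrite inE => ->; rewrite andbT.
by apply: contraTneq lM' => ->; apply: Ess_minorN.
Qed.

Lemma exists_notin (A : {set 'I_n}) : (#|A| < n)%N -> exists i, i \notin A.
Proof.
move=> ltA; apply/existsP; apply: contraTT ltA; rewrite negb_exists.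
move/forallP => inA; rewrite -leqNgt -[X in (X <= _)%N]card_ord.
rewrite -cardsT; apply: subset_leq_card.
by apply/subsetP => i _; rewrite -[_ \in A]negbK inA.
Qed.

(** * Agreement with a low-arity function on the hyperplanes $x_i = x_j$ *)

Definition agree_on f g i j := forall a, a i = a j -> f a = g a.

(** Setting $x_v$ to $x_w$ turns [minor f t u] into [g], because the resulting point still satisfies
    $x_v = x_w$ and [g] ignores $x_t$ and $x_v$. Hence [Ess g] lies in [Ess (minor f t u)], and the
    bound on arities forces equality. So the minor ignores $x_v$ as well, and the substitution can
    be undone. *)
Lemma agree_on_propagate f g t u v w :
    t \notin Ess g -> v \notin Ess g -> w \notin Ess g ->
    t != v -> t != w -> t != u -> v != w ->
    (ess (minor f t u) <= ess g)%N ->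
  agree_on f g v w -> agree_on f g t u.
Proof.
move=> tN vN wN tv tw tu vw le_ess fg.
have keyE a : minor f t u (subst_at a v (a w)) = g a.
  rewrite minorE fg; first by rewrite !inessential.
  rewrite !subst_atE eqxx ![_ == t]eq_sym (negbTE tv) (negbTE tw).
  by rewrite eq_sym (negbTE vw).
have subE : Ess g \subset Ess (minor f t u).
  apply/subsetP => e eE.
  have ev : e != v by apply: contraNneq vN => <-.
  have ew : e != w by apply: contraNneq wN => <-.
  have [a [x gx]] := essentialP _ _ eE.
  apply/essentialP; exists (subst_at a v (a w)), x.
  suff -> : subst_at (subst_at a v (a w)) e x =
            subst_at (subst_at a e x) v (subst_at a e x w) by rewrite !keyE.
  apply/ffunP => l; rewrite !subst_atE [w == e]eq_sym (negbTE ew).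
  by case: (eqVneq l v) => [->|//]; rewrite eq_sym (negbTE ev).
have EE : Ess g = Ess (minor f t u) by apply/eqP; rewrite eqEcard subE.
move=> a eq_a; rewrite -(minor_id f t u a eq_a) -(@inessential _ v _ (a w)) ?keyE //.
by rewrite -EE.
Qed.

Lemma agree_on_all f r s :
    let h := minor f r s in
    r != s -> s \notin Ess h -> (ess h + 3 <= n)%N ->
    (forall i j, i != j -> (ess (minor f i j) <= ess h)%N) ->
  forall i j, i != j -> agree_on f h i j.
Proof.
move=> h rs sN le_n le_h.
have rN : r \notin Ess h by apply: Ess_minorN.
have fh_rs : agree_on f h r s by move=> a eq_a; rewrite /h minor_id.
(* A third inessential variable of [h], besides $x_r$ and $x_s$, lets each of these two be treated
   with the other two as pivots. *)
have [t0] : exists t, t \notin [set r; s] :|: Ess h.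
  apply: exists_notin; apply: leq_ltn_trans (leq_card_setU _ _) _.
  by rewrite cards2 rs -/(ess h); lia.
rewrite in_setU in_set2 !negb_or => /andP[/andP[tr ts] t0N].
have fh_t u : t0 != u -> agree_on f h t0 u.
  by move=> tu; apply: (@agree_on_propagate _ _ t0 u r s) => //; apply: le_h.
have fhN t u : t \notin Ess h -> t != u -> agree_on f h t u.
  move=> tN tu.
  have [t_r|tNr] := eqVneq t r.
    subst t; apply: (@agree_on_propagate _ _ r u t0 s); rewrite // 1?eq_sym //.
      by rewrite le_h // eq_sym.
    exact: fh_t.
  have [t_s|tNs] := eqVneq t s.
    subst t; apply: (@agree_on_propagate _ _ s u t0 r); rewrite // 1?eq_sym //.
      by rewrite le_h // eq_sym.
    exact: fh_t.
  by apply: (@agree_on_propagate _ _ t u r s) => //; apply: le_h.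
move=> d e de a eq_a.
(* Within $x_d = x_e$, giving $x_{t_0}$ the common value reaches the hyperplane $x_{t_0} = x_d$,
   which [fhN] covers. *)
have fh_at_t b x : b d = x -> b e = x -> t0 != d -> t0 != e ->
    minor f d e (subst_at b t0 x) = h b.
  move=> bd be td te; rewrite minor_id; last first.
    by rewrite !subst_atE ![_ == t0]eq_sym (negbTE td) (negbTE te) bd be.
  rewrite (fhN t0 d) ?inessential // !subst_atE eqxx.
  by rewrite [d == t0]eq_sym (negbTE td).
have [t_d|td] := eqVneq t0 d; first by subst d; apply: fhN eq_a.
have [t_e|te] := eqVneq t0 e; first by subst e; apply: (fhN t0 d).
pose M := minor f d e.
have fM : f a = M a by rewrite /M minor_id.
have Mt : M (subst_at a t0 (a d)) = h a by apply: fh_at_t.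
have [tM|tM] := boolP (t0 \in Ess M); last by rewrite fM -Mt inessential.
(* The variable [x_c] is inessential on the hyperplane [x_d = x_e]; setting it
   to the value of [x_t0] moves [a] to a point where [f] and [h] agree. *)
have [c] : exists c, c \notin [set d; e] :|: Ess M.
  apply: exists_notin; apply: leq_ltn_trans (leq_card_setU _ _) _.
  by rewrite cards2 de; have := le_h d e de; rewrite -/(ess M) -/M; lia.
rewrite in_setU in_set2 !negb_or => /andP[/andP[cd ce] cM].
have ct : c != t0 by apply: contraNneq cM => ->.
have Mc : M (subst_at a c (a t0)) = h (subst_at a c (a t0)).
  rewrite /M minor_id; last first.
    by rewrite !subst_atE ![_ == c]eq_sym (negbTE cd) (negbTE ce).
  by rewrite (fhN t0 c) 1?eq_sym // !subst_atE eqxx [_ == c]eq_sym (negbTE ct).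
(* As $x_c$ may be essential in [h], the value of [h] at the moved point is first turned back into a
   value of [M] with $x_{t_0}$ set to [a d]. There [M] ignores $x_c$, so the change of $x_c$ can be
   undone. *)
rewrite fM -(@inessential _ c _ (a t0) cM) Mc -(fh_at_t _ (a d)) //; last 2 first.
- by rewrite subst_atE eq_sym (negbTE cd).
- by rewrite subst_atE eq_sym (negbTE ce).
rewrite -Mt -(@inessential _ c (subst_at a t0 _) (a t0) cM) -/M.
congr (M _); apply/ffunP => l; rewrite !subst_atE.
by case: (eqVneq l t0) => [->|//]; rewrite eq_sym (negbTE ct).
Qed.

(** If $x_s$ is essential in [h], the new minor [M] already has [m] essential variables among those
    of [h] and $x_r$. By maximality it has no others, and $x_u$ was chosen outside them. *)
Lemma exists_maximal_minor f m :
    (m + 3 <= n)%N -> (forall i j, i != j -> (ess (minor f i j) <= m)%N) ->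
    (exists r s, r != s /\ ess (minor f r s) = m) ->
  exists r s, [/\ r != s, s \notin Ess (minor f r s) & ess (minor f r s) = m].
Proof.
move=> le_n le_m [r [s [rs ess_h]]]; set h := minor f r s in ess_h *.
have [sE|sN] := boolP (s \in Ess h); last by exists r, s.
have rN : r \notin Ess h by apply: Ess_minorN.
have card_rE : #|r |: Ess h| = m.+1 by rewrite cardsU1 rN -ess_h.
have [u uN] : exists u, u \notin r |: Ess h.
  by apply: exists_notin; rewrite card_rE; lia.
have [t] : exists t, t \notin u |: (r |: Ess h).
  by apply: exists_notin; rewrite cardsU1 uN card_rE; lia.
move: uN; rewrite !in_setU1 !negb_or => /andP[ur uN] /and3P[tu tr tN].
have ts : t != s by apply: contraNneq tN => ->.
have us : u != s by apply: contraNneq uN => ->.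
set M := minor f t u.
have keyM a : M (subst_at a r (a s)) = h a.
  rewrite /M minorE -(@minor_id f r s); first by rewrite -/h !inessential.
  rewrite !subst_atE eqxx ![_ == t]eq_sym (negbTE tr) (negbTE ts).
  by rewrite eq_sym (negbTE rs).
have subM : Ess h :\ s \subset Ess M.
  apply/subsetP => e /setD1P[es eE].
  have er : e != r by apply: contraNneq rN => <-.
  have [a [x hx]] := essentialP _ _ eE.
  apply/essentialP; exists (subst_at a r (a s)), x.
  suff -> : subst_at (subst_at a r (a s)) e x =
            subst_at (subst_at a e x) r (subst_at a e x s) by rewrite !keyM.
  apply/ffunP => l; rewrite !subst_atE [s == e]eq_sym (negbTE es).
  by case: (eqVneq l r) => [->|//]; rewrite eq_sym (negbTE er).
(* If [M] ignored both $x_r$ and $x_s$, then [keyM] would make [h] independent of $x_s$. *)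
have [z zrs zM] : exists2 z, z \in [set r; s] & z \in Ess M.
  have [rM|rM] := boolP (r \in Ess M); first by exists r; rewrite ?set21.
  exists s; rewrite ?set22 //; apply: contraTT sE => sM.
  apply/negP => /essentialP[a [x /eqP[]]].
  by rewrite -keyM -[h a]keyM !inessential.
have zD : z \notin Ess h :\ s.
  case/set2P: zrs => ->; last by rewrite in_setD1 eqxx.
  by rewrite in_setD1 (negbTE rN) andbF.
have subzM : z |: (Ess h :\ s) \subset Ess M by rewrite subUset sub1set zM.
have card_z : #|z |: (Ess h :\ s)| = m.
  by rewrite cardsU1 zD -ess_h /ess (cardsD1 s (Ess h)) sE.
have uz : u != z by case/set2P: zrs => ->.
have ess_M : ess M = m.
  by apply/eqP; rewrite eqn_leq le_m //= -{1}card_z subset_leq_card.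
have EM : z |: (Ess h :\ s) = Ess M.
  by apply/eqP; rewrite eqEcard subzM card_z -/(ess M) ess_M leqnn.
exists t, u; split=> //.
by rewrite -/M -EM in_setU1 in_setD1 (negbTE uz) (negbTE uN) andbF.
Qed.

Lemma agree_on_low_arity f m :
    (m + 3 <= n)%N -> (forall i j, i != j -> (ess (minor f i j) <= m)%N) ->
    (exists r s, r != s /\ ess (minor f r s) = m) ->
  exists h, ess h = m /\ forall i j, i != j -> agree_on f h i j.
Proof.
move=> le_n le_m ex_m.
have [r [s [rs sN ess_h]]] := @exists_maximal_minor f m le_n le_m ex_m.
exists (minor f r s); split=> //.
by apply: agree_on_all => //; rewrite ess_h.
Qed.

(** * The gap, and functions of full gap *)

Lemma ess_minor_le_max f i j :
  Ess f = [set: 'I_n] -> i != j ->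
  (ess (minor f i j) <= \max_(t in Min f) ess t)%N.
Proof.
move=> fT ij; apply: (@leq_bigmax_cond _ (mem (Min f)) (@ess k n)).
rewrite /= inE; apply/existsP; exists i; apply/existsP; exists j.
by rewrite ij fT !in_setT /=.
Qed.

Lemma MinP f g : g \in Min f -> exists i j, i != j /\ g = minor f i j.
Proof.
rewrite inE => /existsP[i /existsP[j /and4P[ij _ _ /eqP ->]]].
by exists i, j.
Qed.

Lemma Ess_shift f h c : (forall a, f a = h a + c) -> Ess f = Ess h.
Proof.
move=> fE; apply/setP => i; apply/essentialP/essentialP => -[a [x ne]];
  exists a, x; move: ne; rewrite !fE; first by apply: contraNN => /eqP ->.
by apply: contraNN => /eqP/addIr ->.
Qed.

Lemma ess0_const g a b : ess g = 0%N -> g a = g b.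
Proof. by move=> /cards0_eq g0; apply: eq_on_Ess => i; rewrite g0 inE. Qed.

Lemma full_gap_minors g :
  (1 < n)%N -> g \in G n n k n ->
  forall i j, i != j -> forall a, minor g i j a = g [ffun=> 0].
Proof.
move=> n1; rewrite inE => /andP[/eqP gn /eqP gapg] i j ij a.
have gT : Ess g = [set: 'I_n].
  by apply/eqP; rewrite eqEcard subsetT cardsT card_ord -/(ess g) gn /=.
have max0 : (\max_(t in Min g) ess t = 0)%N by move: gapg; rewrite /gap gn; lia.
have := @ess_minor_le_max g i j gT ij; rewrite max0 leqn0 => /eqP e0.
(* The zero tuple lies on every hyperplane $x_i = x_j$, so all the constant minors share the value
   of [g] there. *)
by rewrite (@ess0_const _ a [ffun=> 0] e0) minor_id // !ffunE.
Qed.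

(** At a point where [g] is nonzero, replacing any coordinate by another one gives the value 0, so
    every variable is essential. *)
Lemma support_injective_full_gap g :
  (1 < n)%N -> g != 0 -> (forall i j, i != j -> minor g i j = 0) ->
  g \in G n n k n.
Proof.
move=> n1 gN0 gm.
have [a ga] : exists a, g a != 0.
  apply/existsP; apply: contraNT gN0; rewrite negb_exists => /forallP g0.
  by apply/eqP/ffunP => a; rewrite ffunE; apply/eqP; rewrite -[_ == _]negbK g0.
have gT : Ess g = [set: 'I_n].
  apply/setP => i; rewrite [RHS]inE; apply/essentialP.
  have [j] : exists j, j \notin [set i] by apply: exists_notin; rewrite cards1.
  rewrite in_set1 eq_sym => ij; exists a, (a j).
  by rewrite -minorE gm // ffunE eq_sym.
have gn : ess g = n by rewrite /ess gT cardsT card_ord.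
rewrite inE gn eqxx /gap gn big1 ?subn0 ?eqxx // => t /MinP[i [j [ij ->]]].
rewrite gm //; apply/eqP; rewrite cards_eq0; apply/eqP/setP => l.
by rewrite [RHS]inE; apply/negP => /essentialP[b [x]]; rewrite !ffunE eqxx.
Qed.

End Minors.

(** * The decomposition theorem *)

Theorem theorem3p9 (k n p : nat) (f : Pfun k n)
    (hk : (3 <= k)%N) (hp : (2 < p)%N) (hpn : (p < n)%N) (hnk : (n <= k)%N)
    (hf : Ess f = [set: 'I_n]) :
  (f \in G n p k n <->
     exists Y : {set 'I_n}, #|Y| = (n - p)%N /\
       exists h g : Pfun k n,
         f = h + g /\ Ess h = Y /\ g \in G n n k n)
  /\
  (f \in G n p k n ->
     exists Y : {set 'I_n}, #|Y| = (n - p)%N /\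
       exists h g : Pfun k n,
         f = h + g /\ Ess h = Y /\ g \in G n n k n /\
         forall i j : 'I_n, i != j -> minor g i j = 0).
Proof.
have n1 : (1 < n)%N by lia.
have fn : ess f = n by rewrite /ess hf cardsT card_ord.
have decomp : f \in G n p k n ->
     exists Y : {set 'I_n}, #|Y| = (n - p)%N /\
       exists h g : Pfun k n,
         f = h + g /\ Ess h = Y /\ g \in G n n k n /\
         forall i j : 'I_n, i != j -> minor g i j = 0.
  rewrite inE fn eqxx /= /gap fn => /eqP gap_f.
  have max_f : (\max_(t in Min f) ess t = n - p)%N by lia.
  have [| | |h [ess_h fh]] := @agree_on_low_arity k n f (n - p).
  - by lia.
  - by move=> i j ij; rewrite -max_f; apply: ess_minor_le_max.
  (* The maximum is attained once [Min f] is nonempty; an empty [Min f] would give the default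
     maximum 0, while $n - p > 0$. *)
  - have [t tM et] : {t | t \in Min f & \max_(t in Min f) ess t = ess t}.
      apply: eq_bigmax_cond; rewrite lt0n; apply: contraTneq hpn => M0.
      rewrite -leqNgt; move: max_f; rewrite big1; first by lia.
      by move=> t; rewrite (card0_eq M0).
    by have [i [j [ij tE]]] := MinP _ _ _ _ tM; exists i, j; rewrite -tE -et.
  have gm i j : i != j -> minor (f - h) i j = 0.
    move=> ij; apply/ffunP => a; rewrite minorE !ffunE.
    by rewrite (fh i j) ?subrr // !subst_atE eqxx eq_sym (negbTE ij).
  exists (Ess h); split=> //; exists h, (f - h); split; first by rewrite addrC subrK.
  split=> //; split=> //; apply: support_injective_full_gap => //.
  (* If $f = h$, then [f] would have only $n - p < n$ essential variables. *)
  by rewrite subr_eq0; apply: contraTneq hpn => fE; rewrite -fE fn in ess_h; lia.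
split=> //; split=> [/decomp[Y [cY [h [g [fE [hY [gG _]]]]]]]|].
  by exists Y; split=> //; exists h, g.
case=> Y [cY [h [g [fE [hY gG]]]]].
have ess_h : ess h = (n - p)%N by rewrite /ess hY.
have ess_minor_f i j : i != j -> ess (minor f i j) = ess (minor h i j).
  move=> ij; rewrite /ess; congr #|pred_of_set _|.
  apply: (@Ess_shift _ _ _ _ (g [ffun=> 0])) => a.
  by rewrite -(@full_gap_minors _ _ g n1 gG i j ij a) fE !ffunE.
have max_f : (\max_(t in Min f) ess t = n - p)%N.
  apply/eqP; rewrite eqn_leq; apply/andP; split.
    apply/bigmax_leqP => t /MinP[i [j [ij ->]]].
    by rewrite ess_minor_f // -ess_h; apply: ess_minor_le.
  (* The bound is attained by eliminating a variable that [h] ignores, since this leaves [h]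
     unchanged. *)
  have [i iN] : exists i, i \notin Ess h.
    by apply: exists_notin; rewrite -/(ess h) ess_h; lia.
  have [j] : exists j, j \notin [set i] by apply: exists_notin; rewrite cards1.
  rewrite in_set1 eq_sym => ij.
  by rewrite -ess_h -(@minor_inessential _ _ h i j iN) -ess_minor_f // ess_minor_le_max.
by rewrite inE fn eqxx /gap fn max_f; apply/eqP; lia.
Qed.
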